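(* Let $n,p$ be integers with $1<p<n-1$. Then $$C_{n,p}^2\le C_{n-1,p-1}^2+C_{n-1,p}^2 .$$
   Context: Let $\Lambda^p(\mathbf{R}^n)$ be the space of $p$-vectors in $\mathbf{R}^n$ with its standard Euclidean norm $|\cdot|$ (for an orthonormal basis $e_1,\dots,e_n$ of $\mathbf{R}^n$, the $p$-vectors $e_{i_1}\wedge\cdots\wedge e_{i_p}$, $i_1<\cdots<i_p$, are orthonormal), and let $\Lambda^p(\mathbf{R}^n)^*$ be its dual space, the space of $p$-covectors, with the dual Euclidean norm $|\cdot|^*$ (the $e_{i_1}^*\wedge\cdots\wedge e_{i_p}^*$ are orthonormal and form the basis dual to the $e_{i_1}\wedge\cdots\wedge e_{i_p}$). A $p$-vector is simple if it is a wedge product of $p$ vectors. The comass of $\phi\in\Lambda^p(\mathbf{R}^n)^*$ is $$\Vert\phi\Vert^*=\sup\{\phi(\xi):\xi\in\Lambda^p(\mathbf{R}^n)\text{ simple},\ |\xi|\le 1\}.$$ Define $$C_{n,p}=\sup\left\{\frac{|\phi|^*}{\Vert\phi\Vert^*}:\phi\in\Lambda^p(\mathbf{R}^n)^*,\ \phi\ne0\right\}.$$ *)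

(* Defs.v *)
From mathcomp Require Import all_boot all_order all_algebra.
From mathcomp Require Import all_classical all_reals.

Set Implicit Arguments.
Unset Strict Implicit.
Unset Printing Implicit Defensive.

Import Order.TTheory GRing.Theory Num.Theory.
Local Open Scope ring_scope.

(* The index set of the standard basis of the p-th exterior power of R^n:
   the p-subset {i_1 < ... < i_p} stands for e_{i_1} /\ ... /\ e_{i_p}. *)
Notation pset n p := {A : {set 'I_n} | #|A| == p%N}.

(* Lambda^p(R^n), in coordinates with respect to the standard basis. *)
Notation pvector R n p := {ffun pset n p -> R^o}.

(* The dual space Lambda^p(R^n)^*. *)
Notation pcovector R n p := 'Hom(pvector R n p, R^o).

Section ExteriorPower.
Variables (R : realType) (n : nat).

Definition pbasis (p : nat) (A : pset n p) : pvector R n p := [ffun B => (B == A)%:R].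

(* The identification of R^n with Lambda^1(R^n); A is a singleton, so that the
   sum has exactly one term. *)
Definition pvector_of_vector (v : 'rV[R]_n) : pvector R n 1%N :=
  [ffun A : pset n 1%N => (\sum_(i in val A) v 0 i : R^o)].

(* e_A /\ e_B = (-1)^(inversions A B) e_(A :|: B) for disjoint A and B, the
   number of adjacent transpositions needed to sort the indices of A followed
   by those of B. *)
Definition inversions (A B : {set 'I_n}) : nat :=
  #|[set ab : 'I_n * 'I_n | [&& ab.1 \in A, ab.2 \in B & (ab.2 < ab.1)%N]]|.

Definition wedge (p q : nat) (x : pvector R n p) (y : pvector R n q) :
    pvector R n (p + q)%N :=
  [ffun C : pset n (p + q)%N =>
     \sum_(A : pset n p)
       \sum_(B : pset n q | [disjoint val A & val B]
                            && (val A :|: val B == val C))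
         (-1) ^+ inversions (val A) (val B) * x A * y B].

(* v_0 /\ (v_1 /\ ( ... /\ v_(p-1))), the empty product being the unit 1 of
   Lambda^0(R^n) = R. *)
Fixpoint wedge_vectors (p : nat) : ('I_p -> 'rV[R]_n) -> pvector R n p :=
  match p with
  | 0 => fun _ => [ffun=> 1]
  | p'.+1 => fun v =>
      wedge (pvector_of_vector (v ord0))
            (wedge_vectors (fun i : 'I_p' => v (lift ord0 i)))
  end.

Definition simple_pvector (p : nat) (x : pvector R n p) : Prop :=
  exists v : 'I_p -> 'rV[R]_n, x = wedge_vectors v.

Definition pvector_norm (p : nat) (x : pvector R n p) : R :=
  Num.sqrt (\sum_(A : pset n p) x A ^+ 2).

(* phi (pbasis A) is the coordinate of phi along the dual basis vector e_A^*. *)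
Definition pcovector_norm (p : nat) (phi : pcovector R n p) : R :=
  Num.sqrt (\sum_(A : pset n p) phi (pbasis A) ^+ 2).

Definition comass (p : nat) (phi : pcovector R n p) : R :=
  sup [set phi x | x in
         [set x : pvector R n p | simple_pvector x /\ pvector_norm x <= 1]]%classic.

End ExteriorPower.

Definition comass_const (R : realType) (n p : nat) : R :=
  sup [set pcovector_norm phi / comass phi | phi in
         [set phi : pcovector R n p | phi != 0]]%classic.

(* Main.v *)
Require Import Defs.
From HB Require Import structures.
From mathcomp Require Import all_boot all_order all_algebra.
From mathcomp Require Import all_classical all_reals.

Set Implicit Arguments.
Unset Strict Implicit.
Unset Printing Implicit Defensive.

Import Order.TTheory GRing.Theory Num.Theory.
Local Open Scope ring_scope.

(** Split the standard basis of [R^n] into [e_0] and the remaining vectors,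
    which span a copy of [R^(n-1)].  Every [p]-covector [phi] is then uniquely
    [e_0^* /\ a + b], where [a] is a [(p-1)]-covector and [b] a [p]-covector of
    [R^(n-1)], and since a [p]-subset of the indices either contains [0] or not,
    [|phi|^2 = |a|^2 + |b|^2] ([pcovector_norm_split]).

    On [xi] in the exterior algebra of [R^(n-1)] one has
    [a(xi) = phi(e_0 /\ xi)] and [b(xi) = phi(xi)].  Both [xi |-> e_0 /\ xi]
    and the inclusion preserve the norm and send simple multivectors to simple
    ones ([with0_simple], [pushforward_simple]), so that [a] and [b] have comass
    at most that of [phi] ([comass_pullback]).  Therefore
      [|phi|^2 <= C_{n-1,p-1}^2 ||a||^2 + C_{n-1,p}^2 ||b||^2
               <= (C_{n-1,p-1}^2 + C_{n-1,p}^2) ||phi||^2],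
    and the theorem follows by taking the supremum over [phi].

    The first inequality requires the suprema defining [C] to be finite.  They
    are, because the basis multivectors and their opposites are simple of norm
    one: every coefficient of [phi] is bounded by its comass, whence
    [|phi| <= sqrt(N) ||phi||] with [N] the number of coefficients
    ([norm_le_card_comass]). *)

Definition mkpset n p (A : {set 'I_n}) (cA : #|A| == p) : pset n p :=
  exist _ A cA.

(** * Transport of multivectors along maps of basis indices *)

Section Pushforward.
Variables (R : realType) (m n p q : nat) (f : pset m p -> pset n q).

(** The linear extension of [f] from basis elements to multivectors.  Summing
    over the fibres of [f] defines it without an inverse of [f]. *)
Definition pushforward (x : pvector R m p) : pvector R n q :=
  [ffun C => (\sum_(A | f A == C) x A : R^o)].

Lemma pushforward_is_linear : linear pushforward.
Proof.
move=> c x y; apply/ffunP => C; rewrite !ffunE /= scaler_sumr -big_split /=.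
by apply: eq_bigr => A _; rewrite !ffunE.
Qed.

HB.instance Definition _ :=
  GRing.isLinear.Build R (pvector R m p) (pvector R n q) _ pushforward
    pushforward_is_linear.

(** Contraction with [e_0] and restriction to a coordinate hyperplane are both
    of this form, for suitable [f]. *)
Definition pullback (phi : pcovector R n q) : pcovector R m p :=
  (phi \o linfun pushforward)%VF.

Lemma pullbackE phi x : pullback phi x = phi (pushforward x).
Proof. by rewrite comp_lfunE lfunE. Qed.

Lemma pushforward_pbasis A : pushforward (pbasis R A) = pbasis R (f A).
Proof.
apply/ffunP => C; rewrite !ffunE.
under eq_bigr do rewrite ffunE.
rewrite eq_sym; have [fA|fA] := eqVneq (f A) C.
  rewrite (bigD1 A) ?fA //= eqxx big1 ?addr0 // => B /andP[_ /negPf->] //.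
by rewrite big1 // => B /eqP fB; case: eqP => // BA; rewrite -fB BA eqxx in fA.
Qed.

Lemma pushforward_norm x : injective f ->
  pvector_norm (pushforward x) = pvector_norm x.
Proof.
move=> f_inj; congr (Num.sqrt _); rewrite [RHS](partition_big f xpredT) //=.
apply: eq_bigr => C _; rewrite ffunE.
case: (pickP (fun A => f A == C)) => [A /eqP fA|fC]; last first.
  by rewrite !big_pred0 // expr0n.
have E : (fun B => f B == C) =1 pred1 A by move=> B /=; rewrite -fA (inj_eq f_inj).
by rewrite !(eq_bigl _ _ E) !big_pred1_eq.
Qed.

End Pushforward.

(** * Wedge products with a vector *)

Section Wedge.
Variables (R : realType) (n : nat).

Lemma set1_card (i : 'I_n) : #|[set i]%SET| == 1%N.
Proof. by rewrite cards1. Qed.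

Definition pset1 (i : 'I_n) : pset n 1 := mkpset (set1_card i).

Lemma pset1P (A : pset n 1) i : (i \in val A) = (A == pset1 i).
Proof.
rewrite -val_eqE /=; case: A => A /= /cards1P[j ->].
by rewrite inE (inj_eq set1_inj) eq_sym.
Qed.

Lemma pvector_of_delta i :
  pvector_of_vector (delta_mx 0 i : 'rV[R]_n) = pbasis R (pset1 i).
Proof.
apply/ffunP => A; rewrite !ffunE -pset1P.
under eq_bigr do rewrite mxE eqxx /=.
case: (boolP (i \in val A)) => iA.
  by rewrite (bigD1 i) //= eqxx big1 ?addr0 // => j /andP[_ /negPf->].
by rewrite big1 // => j jA; case: eqP => // ji; rewrite -ji jA in iA.
Qed.

(** The left factor [e_i] has a single nonzero coefficient, which leaves only
    the inner sum of the wedge product. *)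
Lemma wedge_delta p i (y : pvector R n p) (C : pset n (1 + p)) :
  wedge (pvector_of_vector (delta_mx 0 i)) y C =
  \sum_(B : pset n p | (i \notin val B) && (i |: val B == val C)%SET)
    (-1) ^+ inversions [set i]%SET (val B) * y B.
Proof.
rewrite pvector_of_delta ffunE (bigD1 (pset1 i)) //= [X in _ + X]big1 ?addr0.
  by apply: eq_big => [B|B _]; rewrite ?disjoints1 // ffunE eqxx mulr1.
by move=> A /negPf iA; rewrite big1 // => B _; rewrite ffunE iA mulr0 mul0r.
Qed.

Lemma wedgeZl p q c (x : pvector R n p) (y : pvector R n q) :
  wedge (c *: x) y = c *: wedge x y.
Proof.
apply/ffunP => C; rewrite !ffunE /= scaler_sumr; apply: eq_bigr => A _.
rewrite scaler_sumr; apply: eq_bigr => B _; rewrite ffunE /=.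
by rewrite /GRing.scale /= mulrCA !mulrA.
Qed.

Lemma pvector_of_vectorZ c (v : 'rV[R]_n) :
  pvector_of_vector (c *: v) = c *: pvector_of_vector v.
Proof.
apply/ffunP => A; rewrite !ffunE /= scaler_sumr.
by apply: eq_bigr => i _; rewrite mxE.
Qed.

Definition ord_cons p (u : 'rV[R]_n) (v : 'I_p -> 'rV[R]_n) (i : 'I_p.+1) :=
  if unlift ord0 i is Some j then v j else u.

(** Stated for [ord_cons] so that a simple multivector can be extended by a
    vector without computing with [lift] and [unlift] again. *)
Lemma wedge_vectors_cons p u (v : 'I_p -> 'rV[R]_n) :
  wedge_vectors (ord_cons u v) = wedge (pvector_of_vector u) (wedge_vectors v).
Proof.
rewrite /= {1}/ord_cons unlift_none.
by rewrite (_ : (fun i => _) = v) //; apply/funext => i; rewrite /ord_cons liftK.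
Qed.

(** The scalar is absorbed by the first vector; in degree [0] there is none, and
    indeed [1] is then the only simple element. *)
Lemma simple_scale p c (x : pvector R n p.+1) :
  simple_pvector x -> simple_pvector (c *: x).
Proof.
case=> v ->.
exists (ord_cons (c *: v ord0) (fun i => v (lift ord0 i))).
by rewrite wedge_vectors_cons pvector_of_vectorZ wedgeZl.
Qed.

Lemma simple_pvector0 p : simple_pvector (0 : pvector R n p.+1).
Proof.
rewrite -(scale0r (wedge_vectors (fun=> 0))).
by apply: simple_scale; exists (fun=> 0).
Qed.

Lemma wedge_delta_pbasis p i (B : pset n p) (C : pset n (1 + p)) c :
  i \notin val B -> (i |: val B)%SET = val C ->
  wedge (pvector_of_vector (delta_mx 0 i)) (c *: pbasis R B) =
  ((-1) ^+ inversions [set i]%SET (val B) * c) *: pbasis R C.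
Proof.
move=> iB eC; apply/ffunP => D; rewrite wedge_delta !ffunE.
rewrite /GRing.scale /=.
have [->|DC] := eqVneq D C.
  rewrite (bigD1 B) /= ?iB ?eC ?eqxx // !ffunE eqxx /GRing.scale /= !mulr1.
  rewrite big1 ?addr0 // => B' /andP[_ /negPf B'B].
  by rewrite !ffunE B'B /GRing.scale /= !mulr0.
rewrite mulr0 big1 // => B' /andP[_ /eqP eD]; rewrite !ffunE /GRing.scale /=.
case: eqP => [B'B|_]; last by rewrite !mulr0.
by rewrite B'B eC in eD; rewrite (val_inj eD) eqxx in DC.
Qed.

(** Removing an arbitrary index of [A] at each step gives [e_A] as a wedge of
    basis vectors up to sign.  Leaving the sign unspecified avoids sorting [A];
    in positive degree it is absorbed by [simple_scale]. *)
Lemma signed_pbasis_simple p (A : pset n p) :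
  exists k : nat, simple_pvector ((-1) ^+ k *: pbasis R A).
Proof.
elim: p A => [|p IHp] A.
  exists 0%N, (fun=> 0); apply/ffunP => B; rewrite !ffunE expr0 scale1r.
  rewrite (_ : B = A) ?eqxx //; apply: val_inj.
  by rewrite (cards0_eq (eqP (valP A))) (cards0_eq (eqP (valP B))).
have /card_gt0P[i iA] : (0 < #|val A|)%N by rewrite (eqP (valP A)).
have cB : #|val A :\ i|%SET == p.
  by have := valP A; rewrite /= (cardsD1 i (val A)) iA eqSS.
have [k [v vE]] := IHp (mkpset cB).
exists (inversions [set i]%SET (val A :\ i)%SET + k)%N, (ord_cons (delta_mx 0 i) v).
rewrite wedge_vectors_cons exprD -(wedge_delta_pbasis (B := mkpset cB) (C := A)) -?vE //=.
  by rewrite !inE eqxx.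
by rewrite finset.setD1K.
Qed.

Lemma pbasis_simple p (A : pset n p.+1) : simple_pvector (pbasis R A).
Proof.
have [k] := signed_pbasis_simple A.
by move=> /(simple_scale ((-1) ^+ k)); rewrite scalerA -expr2 sqrr_sign scale1r.
Qed.

Lemma pvector_norm_pbasis p (A : pset n p) : pvector_norm (pbasis R A) = 1.
Proof.
rewrite /pvector_norm (bigD1 A) //= ffunE eqxx big1 ?addr0 ?expr1n ?sqrtr1 //.
by move=> B /negPf BA; rewrite ffunE BA expr0n.
Qed.

End Wedge.

(** * Simple multivectors under a strictly increasing map of indices *)

Section Monotone.
Variables (R : realType) (m n : nat) (f : 'I_m -> 'I_n).
Hypothesis f_mono : {mono f : i j / (i < j)%N}.

Lemma mono_ord_inj : injective f.
Proof.
move=> i j fij; have ij := f_mono i j; have ji := f_mono j i.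
rewrite fij ltnn in ij; rewrite fij ltnn in ji.
apply: ord_inj; case: (ltngtP i j) => // lt; first by rewrite lt in ij.
by rewrite lt in ji.
Qed.

Lemma image_card p (A : pset m p) : #|f @: val A|%SET == p.
Proof. by rewrite card_imset ?(valP A) //; apply: mono_ord_inj. Qed.

Definition image_pset p (A : pset m p) : pset n p := mkpset (image_card A).

Lemma image_pset_inj p : injective (@image_pset p).
Proof. by move=> A B [/(imset_inj mono_ord_inj)/val_inj]. Qed.

(** Signs in wedge products depend on the order of the indices: an injective
    map that is not increasing would change them. *)
Lemma image_inversions (A B : {set 'I_m}) :
  inversions (f @: A)%SET (f @: B)%SET = inversions A B.
Proof.
have g_inj : injective (fun ab : 'I_m * 'I_m => (f ab.1, f ab.2)).
  by move=> [a b] [c d] /= [/mono_ord_inj-> /mono_ord_inj->].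
rewrite /inversions -(card_imset _ g_inj); apply: eq_card => -[a b]; rewrite inE /=.
apply/and3P/imsetP => [[/imsetP[a' Aa ->] /imsetP[b' Bb ->]]|].
  by rewrite f_mono => ab; exists (a', b'); rewrite // inE /= Aa Bb.
case=> -[a' b']; rewrite inE /= => /and3P[Aa Bb ab] [-> ->].
by rewrite !imset_f // f_mono.
Qed.

Definition image_vector (v : 'rV[R]_m) : 'rV[R]_n :=
  \row_j \sum_(i | f i == j) v 0 i.

(** Both sides have the coefficient [v_i] at the singleton [{f i}]; as
    [pvector_of_vector] sums over the elements of a singleton, the proof writes
    either coefficient as the sum of the [v_i] with [f i] in [C]. *)
Lemma pushforward_vector v :
  pvector_of_vector (image_vector v) =
  pushforward (@image_pset 1) (pvector_of_vector v).
Proof.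
apply/ffunP => C; rewrite !ffunE.
transitivity (\sum_(i | f i \in val C) v 0 i).
  rewrite (partition_big f (mem (val C))) //=; apply: eq_bigr => j jC.
  by rewrite mxE; apply: eq_bigl => i; case: eqP => [->|]; rewrite ?jC ?andbF.
under [RHS]eq_bigr do rewrite ffunE.
rewrite (exchange_big_dep xpredT) //= [LHS]big_mkcond /=; apply: eq_bigr => i _.
have E A : (image_pset A == C) && (i \in val A) = (f i \in val C) && (A == pset1 i).
  rewrite !pset1P; case: (A =P pset1 i) => [->|_]; rewrite ?andbF // !andbT.
  by rewrite eq_sym -[LHS]val_eqE -[RHS]val_eqE /= imset_set1.
by rewrite (eq_bigl _ _ E); case: ifP => _; rewrite ?big_pred1_eq ?big_pred0.
Qed.

(** Exterior powers are functorial: the map induced by [f] is multiplicative.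
    Both coefficients at [C] are sums over the pairs [(A, B)] whose images are
    disjoint with union [C]; on the left these are grouped by the images of [A]
    and [B], on the right by the union of [A] and [B]. *)
Lemma pushforward_wedge p q (x : pvector R m p) (y : pvector R m q) :
  wedge (pushforward (@image_pset p) x) (pushforward (@image_pset q) y) =
  pushforward (@image_pset (p + q)) (wedge x y).
Proof.
apply/ffunP => C; rewrite !ffunE.
transitivity (\sum_(A : pset m p) \sum_(B : pset m q |
     [disjoint f @: val A & f @: val B]%SET
     && (f @: val A :|: f @: val B == val C)%SET)
     (-1) ^+ inversions (val A) (val B) * x A * y B).
  rewrite [RHS](partition_big (@image_pset p) xpredT) //=; apply: eq_bigr => A' _.
  rewrite [RHS](exchange_big_dep (fun B : pset m q =>
    [disjoint val A' & f @: val B]%SET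
      && (val A' :|: f @: val B == val C)%SET)) /=; last first.
    by move=> A B /eqP <-.
  rewrite [RHS](partition_big (@image_pset q) (fun B : pset n q =>
    [disjoint val A' & val B] && (val A' :|: val B == val C)%SET)) //=.
  apply: eq_bigr => B' B'P; rewrite !ffunE mulr_sumr.
  apply: eq_big => [B|B /eqP eB].
    by case: eqP => [eB|]; rewrite ?andbF // -eB /= in B'P *; rewrite B'P.
  rewrite mulr_sumr mulr_suml; apply: eq_big => [A|A /eqP eA].
    case: eqP => [eA|//]; rewrite /= -eA -eB /= in B'P.
    by rewrite B'P.
  by rewrite -eA -eB /= image_inversions.
under [RHS]eq_bigr do rewrite ffunE.
rewrite [RHS]exchange_big /=; apply: eq_bigr => A _.
rewrite (exchange_big_dep xpredT) //= [LHS]big_mkcond /=; apply: eq_bigr => B _.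
rewrite (imset_disjoint mono_ord_inj) -imsetU.
case: ifPn => [/andP[dAB /eqP eC]|nAB]; last first.
  rewrite big_pred0 // => D; apply: contraNF nAB => /and3P[/eqP<- -> /eqP ->] /=.
  exact: eqxx.
have cD : #|val A :|: val B|%SET == (p + q)%N.
  by rewrite cardsU disjoint_setI0 // cards0 subn0 (eqP (valP A)) (eqP (valP B)).
rewrite (big_pred1 (mkpset cD)) // => D /=.
rewrite dAB -[D == mkpset cD]val_eqE /=.
apply/andP/eqP => [[_ /eqP ->] // | eD]; rewrite eD eqxx; split=> //.
by rewrite -val_eqE /= eD eC.
Qed.

(** The exterior power of a linear map acts on a product of vectors factor by
    factor, so it preserves simplicity. *)
Lemma pushforward_wedge_vectors p (v : 'I_p -> 'rV[R]_m) :
  wedge_vectors (image_vector \o v) = pushforward (@image_pset p) (wedge_vectors v).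
Proof.
elim: p v => [|p IHp] v /=; last first.
  (* [1 + p] and [p.+1] are only convertible, hence no direct rewriting. *)
  have := pushforward_wedge (pvector_of_vector (v ord0))
            (wedge_vectors (fun i => v (lift ord0 i))).
  by rewrite -IHp -pushforward_vector.
apply/ffunP => C; rewrite !ffunE.
have c0 : #|@finset.set0 'I_m| == 0%N by rewrite cards0.
rewrite (big_pred1 (mkpset c0)) ?ffunE // => A /=.
rewrite -!val_eqE /= (cards0_eq (eqP (valP A))) (cards0_eq (eqP (valP C))).
by rewrite imset0 !eqxx.
Qed.

Lemma pushforward_simple p (x : pvector R m p) :
  simple_pvector x -> simple_pvector (pushforward (@image_pset p) x).
Proof. by case=> v ->; exists (image_vector \o v); rewrite pushforward_wedge_vectors. Qed.

End Monotone.

(** * Splitting off the first coordinate *)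

Section FirstCoordinate.
Variables (R : realType) (m : nat).

Lemma lift0_mono : {mono @lift m.+1 ord0 : i j / (i < j)%N}.
Proof. by move=> i j; rewrite !lift0 ltnS. Qed.

(** The index [0] is split off, and not the last one, because [e_0] stands first
    in a sorted product, so that wedging with [e_0] on the left costs no sign. *)
Definition without0 p : pset m p -> pset m.+1 p := image_pset lift0_mono (p := p).

Lemma lift0_notin (B : {set 'I_m}) : ord0 \notin (lift ord0 @: B)%SET.
Proof. by apply/imsetP => -[i _ /eqP]; rewrite (negPf (neq_lift _ _)). Qed.

Lemma with0_card p (A : pset m p) : #|ord0 |: val (without0 A)|%SET == p.+1.
Proof. by rewrite cardsU1 lift0_notin (eqP (valP (without0 A))). Qed.

Definition with0 p (A : pset m p) : pset m.+1 p.+1 := mkpset (with0_card A).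

Lemma with0_inj p : injective (@with0 p).
Proof.
move=> A B [/(congr1 (fun S => S :\ ord0)%SET)].
by rewrite !setU1K ?lift0_notin // => /(imset_inj (mono_ord_inj lift0_mono))/val_inj.
Qed.

(** The combinatorial operation of adding the index [0] is left multiplication
    by [e_0], which is why it preserves simplicity. *)
Lemma pushforward_with0 p (x : pvector R m p) :
  pushforward (@with0 p) x =
  wedge (pvector_of_vector (delta_mx 0 ord0)) (pushforward (@without0 p) x).
Proof.
apply/ffunP => C; rewrite wedge_delta ffunE.
rewrite [LHS](partition_big (@without0 p)
  (fun B => (ord0 \notin val B) && (ord0 |: val B == val C)%SET)) /=; last first.
  by move=> A /eqP <-; rewrite lift0_notin /=.
apply: eq_bigr => B /andP[_ /eqP eC].
(* No index is smaller than [0], so every sign is [+1]. *)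
rewrite (_ : inversions _ _ = 0%N); last first.
  by apply: eq_card0 => -[a b]; rewrite !inE /=; case: eqP => [->|//]; rewrite andbF.
rewrite expr0 mul1r ffunE; apply: eq_bigl => A.
case: (without0 A =P B) => [eB|]; rewrite ?andbF // andbT.
by rewrite -val_eqE /= -eC -eB eqxx.
Qed.

Lemma with0_simple p (x : pvector R m p) :
  simple_pvector x -> simple_pvector (pushforward (@with0 p) x).
Proof.
move=> /(pushforward_simple lift0_mono)[v vE]; rewrite pushforward_with0.
by exists (ord_cons (delta_mx 0 ord0) v); rewrite wedge_vectors_cons -vE.
Qed.

Lemma lift0_image_preimage (S : {set 'I_m.+1}) :
  (lift ord0 @: (lift ord0 @^-1: S) = S :\ ord0)%SET.
Proof.
apply/setP => i; rewrite !inE; apply/imsetP/andP => [[j + ->]|[]].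
  by rewrite inE eq_sym neq_lift.
by case: (unliftP ord0 i) => [j ->|-> /eqP//] _ jS; exists j; rewrite ?inE.
Qed.

Lemma lift0_preimage_card (S : {set 'I_m.+1}) :
  #|(lift ord0 @^-1: S)%SET| = #|(S :\ ord0)%SET|.
Proof. by rewrite -lift0_image_preimage card_imset //; apply: lift_inj. Qed.

(** Pascal's rule, as a bijection of index sets. *)
Lemma pset_split p (F : pset m.+1 p.+1 -> R) :
  \sum_C F C = \sum_A F (with0 A) + \sum_A F (without0 A).
Proof.
rewrite (bigID (fun C : pset m.+1 p.+1 => ord0 \in val C)) /=; congr (_ + _).
- rewrite -(big_imset F (in2W (@with0_inj p))) /=; apply: eq_bigl => C.
  apply/idP/imsetP => [C0|[A _ ->]]; last by rewrite !inE eqxx.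
  have cA : #|(lift ord0 @^-1: val C)%SET| == p.
    by have := valP C; rewrite /= lift0_preimage_card (cardsD1 ord0 (val C)) C0 eqSS.
  exists (mkpset cA) => //; apply: val_inj.
  by rewrite /= lift0_image_preimage finset.setD1K.
- rewrite -(big_imset F (in2W (@image_pset_inj _ _ _ lift0_mono p.+1))) /=.
  apply: eq_bigl => C; apply/idP/imsetP => [C0|[A _ ->]]; last exact: lift0_notin.
  have cA : #|(lift ord0 @^-1: val C)%SET| == p.+1.
    by have := valP C; rewrite /= lift0_preimage_card (cardsD1 ord0 (val C)) (negPf C0).
  exists (mkpset cA) => //; apply: val_inj; rewrite /= lift0_image_preimage.
  by apply/esym/finset.setDidPl; rewrite disjoint_sym disjoints1.
Qed.

(** The decomposition [phi = e_0^* /\ a + b] is orthogonal. *)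
Lemma pcovector_norm_split p (phi : pcovector R m.+1 p.+1) :
  pcovector_norm phi ^+ 2 =
  pcovector_norm (pullback (@with0 p) phi) ^+ 2
    + pcovector_norm (pullback (@without0 p.+1) phi) ^+ 2.
Proof.
rewrite !sqr_sqrtr; try by apply: sumr_ge0 => A _; apply: sqr_ge0.
rewrite pset_split; congr (_ + _); apply: eq_bigr => A _;
  by rewrite pullbackE pushforward_pbasis.
Qed.

End FirstCoordinate.

(** * Finiteness of the comass and of the comass constants *)

Section Comass.
Variables (R : realType).

(** The supremum of the empty set is [0], so that [0 <= b] replaces
    nonemptiness. *)
Lemma sup_le_nonneg (S : set R) (b : R) : 0 <= b -> (forall x, S x -> x <= b) -> sup S <= b.
Proof.
move=> b0 Sb; have [->|/set0P S0] := eqVneq S classical_sets.set0.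
  by rewrite sup0.
exact: ge_sup.
Qed.

(** A set without a supremum has [sup] equal to [0], so that no bound has to be
    known here. *)
Lemma sup_ge0 (S : set R) : (forall x, S x -> 0 <= x) -> 0 <= sup S.
Proof.
move=> S0; have [[[x Sx] Sub]|nS] := pselect (has_sup S); last by rewrite sup_out.
by apply: le_trans (S0 _ Sx) _; apply: ub_le_sup.
Qed.

Lemma pvector_expand n p (x : pvector R n p) : x = \sum_A x A *: pbasis R A.
Proof.
apply/ffunP => B; rewrite sum_ffunE (bigD1 B) //= !ffunE eqxx big1.
  by rewrite /GRing.scale /= mulr1 addr0.
by move=> A AB; rewrite !ffunE eq_sym (negPf AB) /GRing.scale /= mulr0.
Qed.

Lemma coord_le_norm n p (x : pvector R n p) A : `|x A| <= pvector_norm x.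
Proof.
rewrite -sqrtr_sqr ler_wsqrtr // (bigD1 A) //= lerDl.
by apply: sumr_ge0 => B _; apply: sqr_ge0.
Qed.

(** The supremum in the comass is finite: on the unit ball, [phi] is at most the
    sum of the absolute values of its coefficients. *)
Lemma le_comass n p (phi : pcovector R n p) (x : pvector R n p) :
  simple_pvector x -> pvector_norm x <= 1 -> phi x <= comass phi.
Proof.
move=> xs x1; apply: ub_le_sup; last by exists x.
exists (\sum_A `|phi (pbasis R A)|) => _ [y [_ y1] <-].
rewrite [y in phi y]pvector_expand linear_sum /=; apply: ler_sum => A _.
rewrite linearZ /=; apply: le_trans (ler_norm _) _; rewrite normrM.
by rewrite ler_piMl // (le_trans (coord_le_norm _ _)).
Qed.

Lemma comass_ge0 n p (phi : pcovector R n p.+1) : 0 <= comass phi.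
Proof.
rewrite -(linear0 phi); apply: le_comass; first exact: simple_pvector0.
by rewrite /pvector_norm big1 ?sqrtr0 // => A _; rewrite ffunE expr0n.
Qed.

(** An isometric embedding that preserves simplicity carries the competitors in
    one comass to competitors in the other. *)
Lemma comass_pullback m n p q (f : pset m p -> pset n q.+1) (phi : pcovector R n q.+1) :
  injective f ->
  (forall x : pvector R m p, simple_pvector x -> simple_pvector (pushforward f x)) ->
  comass (pullback f phi) <= comass phi.
Proof.
move=> f_inj fs; apply: sup_le_nonneg (comass_ge0 _) _ => _ [x [xs x1] <-].
by rewrite pullbackE le_comass ?pushforward_norm //; apply: fs.
Qed.

(** Both [e_A] and [- e_A] compete in the comass. *)
Lemma coef_le_comass n p (phi : pcovector R n p.+1) A :
  `|phi (pbasis R A)| <= comass phi.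
Proof.
have sA := pbasis_simple R A.
have nA : pvector_norm (- 1 *: pbasis R A) <= 1.
  rewrite -[leRHS](pvector_norm_pbasis R A) le_eqVlt; apply/orP; left; apply/eqP.
  by congr Num.sqrt; apply: eq_bigr => B _; rewrite ffunE scaleN1r sqrrN.
rewrite ler_norml (le_comass phi sA) ?pvector_norm_pbasis // andbT lerNl.
by have := le_comass phi (simple_scale (- 1) sA) nA; rewrite linearZ /= scaleN1r.
Qed.

Lemma norm_le_card_comass n p (phi : pcovector R n p.+1) :
  pcovector_norm phi <= Num.sqrt #|{: pset n p.+1}|%:R * comass phi.
Proof.
rewrite -[comass phi](ger0_norm (comass_ge0 _)) -sqrtr_sqr -sqrtrM ?ler0n //.
apply: ler_wsqrtr; rewrite mulr_natl -sumr_const; apply: ler_sum => A _.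
by rewrite -real_normK ?num_real // lerXn2r ?nnegrE ?comass_ge0 ?coef_le_comass.
Qed.

Lemma comass_const_ge0 n p : 0 <= comass_const R n p.+1.
Proof.
by apply: sup_ge0 => _ [phi _ <-]; rewrite divr_ge0 ?sqrtr_ge0 ?comass_ge0.
Qed.

(** If the comass is [0] then so is the quotient, by the convention
    [0^-1 = 0]. *)
Lemma norm_comass_ratio_le n p (phi : pcovector R n p.+1) (b : R) : 0 <= b ->
  pcovector_norm phi <= b * comass phi -> pcovector_norm phi / comass phi <= b.
Proof.
move=> b0 phib; have [->|phi0] := eqVneq (comass phi) 0; first by rewrite invr0 mulr0.
by rewrite ler_pdivrMr // lt_neqAle eq_sym phi0 comass_ge0.
Qed.

(** The defining property of the comass constant, which depends on the ratios
    being bounded: otherwise the supremum would be [0]. *)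
Lemma norm_le_const n p (phi : pcovector R n p.+1) :
  pcovector_norm phi <= comass_const R n p.+1 * comass phi.
Proof.
have [phi0|phi0] := eqVneq (comass phi) 0.
  by have := norm_le_card_comass phi; rewrite phi0 !mulr0.
have pos : 0 < comass phi by rewrite lt_neqAle eq_sym phi0 comass_ge0.
rewrite -ler_pdivrMr //; apply: ub_le_sup; last first.
  exists phi => //=; apply: contra_neq phi0 => ->.
  apply/eqP; rewrite eq_le comass_ge0 andbT; apply: sup_le_nonneg => // _ [x _ <-].
  by rewrite zero_lfunE.
exists (Num.sqrt #|{: pset n p.+1}|%:R) => _ [psi _ <-].
by apply: norm_comass_ratio_le (sqrtr_ge0 _) (norm_le_card_comass psi).
Qed.

End Comass.

Theorem proposition2p3 (R : realType) (n p : nat)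
    (hp : (1 < p)%N) (hpn : (p < n - 1)%N) :
  comass_const R n p ^+ 2
    <= comass_const R (n - 1) (p - 1) ^+ 2 + comass_const R (n - 1) p ^+ 2.
Proof.
case: n hpn => [//|m]; case: p hp => [//|[//|q]] _ _; rewrite !subSS !subn0.
set S := _ + _; have S0 : 0 <= S by rewrite addr_ge0 ?sqr_ge0.
rewrite -[leRHS]sqr_sqrtr // lerXn2r ?nnegrE ?sqrtr_ge0 ?comass_const_ge0 //.
apply: sup_le_nonneg (sqrtr_ge0 _) _ => _ [phi _ <-].
apply: norm_comass_ratio_le (sqrtr_ge0 _) _.
(* Applied below to the two components of [phi]. *)
have sq (l r : nat) (psi : pcovector R l r.+1) : comass psi <= comass phi ->
    pcovector_norm psi ^+ 2 <= comass_const R l r.+1 ^+ 2 * comass phi ^+ 2.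
  move=> le_psi; rewrite -exprMn lerXn2r ?nnegrE ?sqrtr_ge0 //.
    by rewrite mulr_ge0 ?comass_const_ge0 ?comass_ge0.
  apply: le_trans (norm_le_const psi) _.
  by rewrite ler_wpM2l ?comass_const_ge0.
rewrite -[leLHS]ger0_norm ?sqrtr_ge0 // -sqrtr_sqr.
rewrite -[comass phi]ger0_norm ?comass_ge0 // -sqrtr_sqr -sqrtrM //.
apply: ler_wsqrtr; rewrite pcovector_norm_split mulrDl lerD //; apply: sq => //.
  by apply: comass_pullback; [exact: with0_inj | exact: with0_simple].
apply: comass_pullback; first exact: image_pset_inj.
exact: pushforward_simple.
Qed.
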